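(* Let $\mathcal K$ be a $d$-dimensional simplicial complex with a gradient vector field $\mathcal V$ on it, and let $\phi_\#:C_\#(\mathcal K,\mathbb Z)\to C_\#(\mathcal K,\mathbb Z)$ be a chain map. Then \[\sum_{q=0}^d(-1)^q\operatorname{tr}(\phi_q)=\sum_{q=0}^d(-1)^q\sum_{\sigma\in\operatorname{Crit}_q^{(\mathcal V)}(\mathcal K)}\big\langle\overleftarrow{\sigma}^{(\mathcal V)},\ \phi_q(\overrightarrow{\sigma}^{(\mathcal V)})\big\rangle .\]
   Context: A simplicial complex $\mathcal K$ is a finite nonempty collection of finite sets closed under subsets (so $\emptyset\in\mathcal K$); $\dim\sigma=|\sigma|-1$; $\alpha$ is a facet of $\beta$ if $\alpha\subseteq\beta$ and $\dim\alpha=\dim\beta-1$. A total order on the vertex set is fixed and a $q$-simplex with vertices $x_0<\dots<x_q$ is the oriented simplex $[x_0,\dots,x_q]$. $C_q(\mathcal K,\mathbb Z)$ is the free $\mathbb Z$-module with basis $S_q(\mathcal K)$, the set of $q$-simplices ($q\ge0$), and is $0$ for $q<0$ or $q>d$. For a $q$-simplex $\sigma=[x_0,\dots,x_q]$ and a $(q-1)$-simplex $\tau$ (where $\tau=\emptyset$ if $q=0$), $[\sigma,\tau]=(-1)^i$ if $\tau=\sigma\setminus\{x_i\}$ and $0$ if $\tau\not\subseteq\sigma$. $\partial_q\sigma=\sum_{\tau\in S_{q-1}}[\sigma,\tau]\tau$ for $q\ge1$, $\partial_0=0$. A chain map is a family of $\mathbb Z$-linear maps $\phi_q:C_q\to C_q$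 with $\partial_q\phi_q=\phi_{q-1}\partial_q$; $\operatorname{tr}(\phi_q)$ is the trace of $\phi_q$ on the free module $C_q$. For $c_1=\sum_i s_i\sigma_i$, $c_2=\sum_i s_i'\sigma_i$ over $S_q(\mathcal K)=\{\sigma_i\}$, $\langle c_1,c_2\rangle=\sum_i s_is_i'$. A discrete vector field $\mathcal V$ is a set of pairs $(\alpha,\beta)$ of simplices ($\alpha=\emptyset$ allowed) with $\alpha$ a facet of $\beta$, each simplex in at most one pair. For $q$-simplices, a $\mathcal V$-trajectory $P:\beta_0,\alpha_1,\beta_1,\dots,\alpha_r,\beta_r$ ($r\ge0$) consists of alternately $q$- and $(q-1)$-simplices with $(\alpha_i,\beta_i)\in\mathcal V$, $\alpha_i\subsetneq\beta_{i-1}$, $\beta_{i-1}\ne\beta_i$; $\mathbf i(P)=\beta_0$, $\mathbf t(P)=\beta_r$, $w(P)=\prod_{i=1}^r(-[\beta_{i-1},\alpha_i][\beta_i,\alpha_i])$ (equal to $1$ if $r=0$); $P$ is nontrivial closed if $r>0$ and $\beta_r=\beta_0$. A co-$\mathcal V$-trajectory $Q:\beta_0,\tau_1,\beta_1,\dots,\tau_r,\beta_r$ consists of alternately $q$- and $(q+1)$-simplices with $(\beta_i,\tau_i)\in\mathcal V$, $\beta_{i-1}\subsetneq\tau_i$, $\beta_{i-1}\neq\beta_i$; $\mathbf i(Q)=\beta_0$, $\mathbf t(Q)=\beta_r$, $w(Q)=\prod_{i=1}^r(-[\tau_i,\beta_{i-1}][\tau_i,\beta_i])$ ($1$ if $r=0$).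 A gradient vector field is a discrete vector field with no nontrivial closed $\mathcal V$-trajectory. A nonempty simplex $\sigma$ is $\mathcal V$-critical if it lies in no pair of $\mathcal V$, or it is a $0$-simplex with $(\emptyset,\sigma)\in\mathcal V$; $\operatorname{Crit}^{(\mathcal V)}_q(\mathcal K)$ is the set of critical $q$-simplices. For $\sigma$ critical, the critical chain is $\overrightarrow{\sigma}^{(\mathcal V)}=\sum_{P:\ \mathbf i(P)=\sigma}w(P)\,\mathbf t(P)$ over all $\mathcal V$-trajectories starting at $\sigma$, and the co-critical chain is $\overleftarrow{\sigma}^{(\mathcal V)}=\sum_{Q:\ \mathbf i(Q)=\sigma}w(Q)\,\mathbf t(Q)$ over all co-$\mathcal V$-trajectories starting at $\sigma$.
   Formalization: V-trajectories are required not to pass through the empty simplex (every α_i is nonempty), so a 0-simplex starts only the trivial V-trajectory; if trajectories of vertices could cross ∅ via a pair (∅,w) in V, the formula would fail. *)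

(* Defs.v *)
From mathcomp Require Import boolp classical_sets fsbigop.
From mathcomp Require Import all_boot all_order all_algebra.

Set Implicit Arguments.
Unset Strict Implicit.
Unset Printing Implicit Defensive.

Import Order.TTheory GRing.Theory Num.Theory.

Local Open Scope ring_scope.

(* Simplices are finite sets of elements of a finite, totally ordered type T;
   the elements of T need not all be vertices of the complex. *)

Section SimplicialComplex.
Context {disp : Order.disp_t} {T : finOrderType disp}.
Implicit Types (s t a b : {set T}) (K : {set {set T}}).

Definition simplicial_complex K : Prop :=
  K != set0 /\ forall s t, s \in K -> t \subset s -> t \in K.

Definition dim s : int := #|s|%:Z - 1.

(* d is an integer because the complex {set0} has dimension -1. *)
Definition has_dimension K (d : int) : Prop :=
  (exists2 s, s \in K & dim s = d) /\ (forall s, s \in K -> dim s <= d).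

Definition facet a b : bool := (a \subset b) && (dim a == dim b - 1).

Definition simplex K (q : nat) : Type :=
  {s : {set T} | (s \in K) && (dim s == q%:Z)}.

(* The vertices x_0 < ... < x_q of s, i.e. the oriented simplex. *)
Definition vertices s : seq T := sort <=%O (enum s).

(* [s, t] : at most one x can satisfy the condition of the pick. *)
Definition incidence s t : int :=
  if [pick x in s | t == s :\ x] is Some x then (-1) ^+ index x (vertices s)
  else 0.

(* int^o is int seen as a module over itself. *)
Definition chain K q : Type := {ffun simplex K q -> int^o}.

Definition basis_chain K q (s : simplex K q) : chain K q :=
  [ffun s' => (s' == s)%:R].

(* This is the boundary map from degree q + 1 to degree q. *)
Definition boundary K q (c : chain K q.+1) : chain K q :=
  \sum_(s : simplex K q.+1)
    c s *: \sum_(t : simplex K q) incidence (val s) (val t) *: basis_chain t.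

(* The remaining condition, in degree 0, reads 0 = 0. *)
Definition chain_map K (phi : forall q, {linear chain K q -> chain K q}) : Prop :=
  forall q (c : chain K q.+1),
    boundary (phi q.+1 c) = phi q (boundary c).

(* The matrix of f in the basis of simplices. *)
Definition chain_mx K q (f : {linear chain K q -> chain K q}) :
    'M[int]_#|{: simplex K q}| :=
  \matrix_(i, j) f (basis_chain (enum_val j)) (enum_val i).

Definition chain_tr K q (f : {linear chain K q -> chain K q}) : int :=
  \tr (chain_mx f).

Definition chain_dot K q (c1 c2 : chain K q) : int :=
  \sum_(s : simplex K q) c1 s * c2 s.

End SimplicialComplex.

Section DiscreteVectorField.
Context {disp : Order.disp_t} {T : finOrderType disp}.
Variables (K : {set {set T}}) (V : {set {set T} * {set T}}).

Definition in_pair (s : {set T}) (p : {set T} * {set T}) : bool :=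
  (s == p.1) || (s == p.2).

Definition discrete_vector_field : Prop :=
  (forall p, p \in V -> [/\ p.1 \in K, p.2 \in K & facet p.1 p.2]) /\
  (forall s p p', p \in V -> p' \in V -> in_pair s p -> in_pair s p' -> p = p').

Section Trajectory.
Variable q : nat.
Implicit Types (b : simplex K q) (P : seq ({set T} * simplex K q)).

(* A trajectory or co-trajectory b_0, x_1, b_1, ..., x_r, b_r is given by b_0
   and the list of the pairs (x_i, b_i). *)

Definition endpoint b P : simplex K q := last b (unzip2 P).

(* The a_i are basis elements of the chain group of degree q - 1, hence
   nonempty: a 0-simplex starts only the trivial trajectory.  The empty simplex
   may occur in V, but must not be crossed by trajectories: a vertex v with
   (set0, v) \in V counts as critical. *)
Fixpoint trajectory b P : bool :=
  if P is (a, b') :: P' then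
    [&& a \in K, a != set0, dim a == q%:Z - 1, (a, val b') \in V,
        a \proper val b, b != b' & trajectory b' P']
  else true.

Fixpoint trajectory_weight b P : int :=
  if P is (a, b') :: P' then
    - (incidence (val b) a * incidence (val b') a) * trajectory_weight b' P'
  else 1.

Fixpoint cotrajectory b P : bool :=
  if P is (t, b') :: P' then
    [&& t \in K, dim t == q%:Z + 1, (val b', t) \in V,
        val b \proper t, b != b' & cotrajectory b' P']
  else true.

Fixpoint cotrajectory_weight b P : int :=
  if P is (t, b') :: P' then
    - (incidence t (val b) * incidence t (val b')) * cotrajectory_weight b' P'
  else 1.

Definition nontrivial_closed b P : bool :=
  (P != [::]) && (endpoint b P == b).

Definition critical : {set simplex K q} :=
  [set s | ~~ [exists p in V, in_pair (val s) p]
           || (q == 0) && ((set0, val s) \in V)].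

(* The sums range over a set of sequences, and have the intended value when
   this set is finite, which is the case for a gradient vector field. *)

Definition critical_chain b : chain K q :=
  \sum_(P \in [set P | trajectory b P]%classic)
    trajectory_weight b P *: basis_chain (endpoint b P).

Definition cocritical_chain b : chain K q :=
  \sum_(P \in [set P | cotrajectory b P]%classic)
    cotrajectory_weight b P *: basis_chain (endpoint b P).

End Trajectory.

Definition gradient_vector_field : Prop :=
  discrete_vector_field /\
  (forall q (b : simplex K q) P, trajectory b P -> ~~ nontrivial_closed b P).

End DiscreteVectorField.

(* Main.v *)
(* For a matched pair (a, b) put W a = - [b, a] b, and let U and H be the
   projections onto the simplices matched with a coface, resp. with a nonempty
   face, so that C = 1 - U - H projects onto the critical simplices.  One step of
   a trajectory is W D + H and one step of a co-trajectory is D W + U, where D is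
   the boundary.  Decomposing (co-)trajectories at their first step, the matrices
   R and L of critical and co-critical chains satisfy R = 1 + R (W D + H) and
   L = 1 + (D W + U) L.  With D D = 0 and H U = 0 this gives

     R C L = 1 + D W L + R W D   and   R W = W L,

   so R C L is homotopic to the identity through W L.  The right-hand side of the
   theorem is the alternating trace of phi R C L, and the homotopy contributes
   nothing to it since phi is a chain map. *)
Require Import Defs.
From mathcomp Require Import classical_sets fsbigop.
From mathcomp Require Import all_boot all_order all_algebra zify ring.

Set Implicit Arguments.
Unset Strict Implicit.
Unset Printing Implicit Defensive.

Import Order.TTheory GRing.Theory Num.Theory.
Local Open Scope ring_scope.

(** * Sums over the walks of a finite graph *)

Section Walks.
Variables (A B : finType) (R : pzRingType).
Variables (step : B -> pred (A * B)) (w : B -> A * B -> R).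

Fixpoint walk b (P : seq (A * B)) : bool :=
  if P is p :: P' then step b p && walk p.2 P' else true.

Fixpoint walk_weight b (P : seq (A * B)) : R :=
  if P is p :: P' then w b p * walk_weight p.2 P' else 1.

(** An explicit duplicate-free list of the walks of length at most [n]. Once lengths are bounded, it
    turns sums over a set of sequences into ordinary finite sums. *)
Fixpoint walks n b : seq (seq (A * B)) :=
  if n is n'.+1 then
    [::] :: [seq p :: P | p <- enum (step b), P <- walks n' p.2]
  else [:: [::]].

Lemma mem_walks n b P : (P \in walks n b) = walk b P && (size P <= n)%N.
Proof.
elim: n b P => [|n IHn] b [|p P] //=; first by rewrite andbF.
rewrite in_cons /= ltnS; apply/allpairsPdep/idP => [[q [Q []]]|].
  by rewrite mem_enum unfold_in IHn => bq bQ [-> ->]; rewrite bq.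
case/andP=> /andP[bp pP] szP; exists p, P; split=> //.
  by rewrite mem_enum.
by rewrite IHn pP.
Qed.

Lemma walks_uniq n b : uniq (walks n b).
Proof.
elim: n b => [//|n IHn] b /=; apply/andP; split.
  by apply/allpairsPdep => -[? [? []]].
apply: allpairs_uniq_dep => [|p _|]; [exact: enum_uniq | exact: IHn |].
by move=> [p P] [q Q] _ _ /= [-> ->].
Qed.

Lemma walk_cat b P Q :
  walk b (P ++ Q) = walk b P && walk (last b (unzip2 P)) Q.
Proof. by elim: P b => [|p P IHP] b //=; rewrite IHP andbA. Qed.

Section Acyclic.
Hypothesis acyclic : forall b P, walk b P -> P != [::] -> last b (unzip2 P) != b.

(** A return to the starting vertex cuts off a nonempty closed prefix, which acyclicity forbids;
    later vertices are handled by induction on the tail. *)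
Lemma walk_uniq b P : walk b P -> uniq (b :: unzip2 P).
Proof.
elim: P b => [|p P IHP] b // bP.
have /= /andP[_ pP] := bP.
suff bNP : b \notin unzip2 (p :: P) by rewrite [uniq _]/= bNP; exact: IHP.
apply/mapP => -[p' Pp' b_p'].
case/path.splitP: Pp' bP => P1 P2; rewrite walk_cat => /andP[/acyclic].
by rewrite /unzip2 map_rcons last_rcons b_p' eqxx -size_eq0 size_rcons => /(_ isT).
Qed.

Lemma size_walk b P : walk b P -> (size P < #|B|)%N.
Proof.
move=> bP; have := max_card (mem (b :: unzip2 P)).
by rewrite (card_uniqP (walk_uniq bP)) /= size_map.
Qed.

End Acyclic.

Section Sum.
Variables (N : nat) (M : lmodType R) (f : B -> M).
Hypothesis walk_bounded : forall b P, walk b P -> (size P <= N)%N.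

Definition walk_sum b : M :=
  \sum_(P \in [set P | walk b P]%classic)
    walk_weight b P *: f (last b (unzip2 P)).

Lemma walk_sumE n b : (N <= n)%N -> walk_sum b =
  \sum_(P <- walks n b) walk_weight b P *: f (last b (unzip2 P)).
Proof.
move=> le_Nn; rewrite fsbig_seq ?walks_uniq //; congr (\big[_/_]_(_ \in _) _).
apply/seteqP; split=> P /=; rewrite mem_walks; last by case/andP.
by move=> bP; rewrite bP (leq_trans (walk_bounded bP)).
Qed.

Lemma walk_sum_rec b :
  walk_sum b = f b + \sum_(p | step b p) w b p *: walk_sum p.2.
Proof.
(* The bound [N.+1] is chosen so that removing the first step leaves the list [walks N], which still
   contains every walk. *)
rewrite (@walk_sumE N.+1) //= big_cons /= scale1r big_allpairs_dep.
rewrite big_enum; congr (_ + _); apply: eq_bigr => p _.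
rewrite (@walk_sumE N) // scaler_sumr; apply: eq_bigr => P _ /=.
by rewrite scalerA.
Qed.

End Sum.
End Walks.

(** * Incidence numbers *)

Section Complex.
Context {disp : Order.disp_t} {T : finOrderType disp}.
Implicit Types (s t a b : {set T}) (x y : T).

Lemma facetP a b : reflect (exists2 x, x \in b & a = b :\ x) (facet a b).
Proof.
apply: (iffP andP) => [[sab /eqP dab]|[x bx ->]].
  have: #|b :\: a| = 1%N.
    have := cardsID a b; rewrite (setIidPr sab).
    by move: dab; rewrite /Defs.dim; lia.
  move/eqP/cards1P => [x bax]; have: x \in b :\: a by rewrite bax set11.
  rewrite inE => /andP[_ bx]; exists x => //.
  by rewrite -bax setDDr setDv set0U (setIidPr sab).
rewrite subD1set; split=> //; apply/eqP.
by rewrite /Defs.dim (cardsD1 x b) bx; lia.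
Qed.

Definition sgn_in s x : int := (-1) ^+ index x (vertices s).

Lemma incidenceD1 s x : x \in s -> incidence s (s :\ x) = sgn_in s x.
Proof.
move=> sx; rewrite /incidence; case: pickP => [y|/(_ x)]; last first.
  by rewrite sx eqxx.
case/andP=> sy /eqP/setP/(_ x); rewrite !inE eqxx sx andbT /=.
by case: eqP => [->|].
Qed.

Lemma incidence0 s t : ~~ facet t s -> incidence s t = 0.
Proof.
move=> Nst; rewrite /incidence; case: pickP => // x /andP[sx /eqP t_sx].
by case/facetP: Nst; exists x.
Qed.

Lemma incidence_sqr s t : incidence s t * incidence s t = (facet t s)%:R.
Proof.
case: (boolP (facet t s)) => [/facetP[x sx ->]|/incidence0->]; last first.
  by rewrite mul0r.
by rewrite incidenceD1 // -expr2 sqrr_sign.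
Qed.

(** Replaces the choice of a vertex by a sum over vertices, so that summations can be exchanged in
    the proof of D D = 0. *)
Lemma incidenceE s t :
  incidence s t = \sum_(x in s) (t == s :\ x)%:R * sgn_in s x.
Proof.
case: (boolP (facet t s)) => [/facetP[x sx ->]|/[dup] Nst /incidence0->].
  rewrite incidenceD1 // (bigD1 x) //= eqxx mul1r big1 ?addr0 // => y.
  case/andP=> sy yNx; case: eqP => [/setP/(_ y)|_]; last by rewrite mul0r.
  by rewrite !inE eqxx yNx sy.
rewrite big1 // => x sx; case: eqP => [t_sx|_]; last by rewrite mul0r.
by case/facetP: Nst; exists x.
Qed.

(** The list is strictly sorted, so the elements before [x] are exactly the smaller ones. Counting
    them makes the effect of deleting a vertex computable. *)
Lemma index_vertices s x :
  x \in s -> index x (vertices s) = #|[set y in s | (y < x)%O]|.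
Proof.
move=> sx; have vs : vertices s =i s by move=> y; rewrite mem_sort mem_enum.
have uvs : uniq (vertices s) by rewrite sort_uniq enum_uniq.
have svs : sorted <%O (vertices s) by rewrite sort_lt_sorted enum_uniq.
set i := index x _.
have lt_i : (i < size (vertices s))%N by rewrite index_mem vs.
rewrite -(size_takel (ltnW lt_i)) -(card_uniqP (take_uniq i uvs)).
apply: eq_card => y; rewrite inE -(vs y).
case: (boolP (y \in vertices s)) => [sy|]; last first.
  by move=> Nsy; apply/negP => /mem_take; exact/negP.
rewrite in_take_leq ?(ltnW lt_i) // -/i.
have ix : index x (vertices s) \in [pred k | (k < size (vertices s))%N] by [].
have iy : index y (vertices s) \in [pred k | (k < size (vertices s))%N].
  by rewrite inE index_mem.
by have := lt_sorted_ltn_nth x svs iy ix; rewrite nth_index // nth_index ?vs // => ->.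
Qed.

(** For [x < y], deleting [x] lowers the position of [y] by one, while deleting [y] leaves that of
    [x] unchanged; this asymmetry is the sign. *)
Lemma sgn_inD1 s x y : x \in s -> y \in s -> x != y ->
  sgn_in s x * sgn_in (s :\ x) y = - (sgn_in s y * sgn_in (s :\ y) x).
Proof.
wlog lt_xy : x y / (x < y)%O => [hw sx sy xNy|].
  have := xNy; rewrite neq_lt => /orP[lt_xy|lt_yx]; first exact: hw.
  by rewrite (hw y x) ?opprK // eq_sym.
move=> sx sy xNy.
have sxy : y \in s :\ x by rewrite !inE eq_sym xNy.
have syx : x \in s :\ y by rewrite !inE xNy.
rewrite /sgn_in !index_vertices //.
have -> : [set z in s :\ y | (z < x)%O] = [set z in s | (z < x)%O].
  apply/setP => z; rewrite !inE; case: eqP => //= ->.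
  by rewrite ltNge (ltW lt_xy) andbF.
rewrite (cardsD1 x [set z in s | (z < y)%O]) !inE sx lt_xy /= add1n exprS.
have -> : [set z in s :\ x | (z < y)%O] = [set z in s | (z < y)%O] :\ x.
  by apply/setP => z; rewrite !inE andbA.
by rewrite mulN1r mulNr opprK mulrC.
Qed.

(* Exchanging the two removed vertices changes the sign of every term. *)
Lemma sum_incidence2 s t :
  \sum_u incidence s u * incidence u t = 0.
Proof.
pose F x y : int := (t == s :\ x :\ y)%:R * (sgn_in s x * sgn_in (s :\ x) y).
have -> : \sum_u incidence s u * incidence u t =
    \sum_(x in s) \sum_(y in s | y != x) F x y.
  under eq_bigr do rewrite incidenceE mulr_suml.
  rewrite exchange_big; apply: eq_bigr => x sx /=.
  rewrite (bigD1 (s :\ x)) //= eqxx mul1r big1 ?addr0 => [|u /negPf->]; last first.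
    by rewrite !mul0r.
  rewrite incidenceE mulr_sumr; apply: eq_big => [y|y _].
    by rewrite !inE andbC.
  by rewrite /F mulrCA.
set S := \sum_(x in s) _; suff: S = - S by lia.
rewrite /S [LHS](exchange_big_dep (mem s)) /=; last by move=> x y _ /andP[].
rewrite -sumrN; apply: eq_bigr => y sy; rewrite -sumrN.
apply: eq_big => [x|x /andP[sx /andP[_ yNx]]]; first by rewrite sy eq_sym.
by rewrite /F (@sgn_inD1 _ y x) // mulrN opprK setDDl setUC -setDDl.
Qed.

End Complex.

(** * Matrices of a discrete vector field *)

Section FunctionMatrix.
Implicit Types I J L : finType.

Definition fun_mx I J (F : I -> J -> int) : 'M[int]_(#|I|, #|J|) :=
  \matrix_(i, j) F (enum_val i) (enum_val j).

Lemma eq_fun_mx I J (F G : I -> J -> int) : F =2 G -> fun_mx F = fun_mx G.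
Proof. by move=> FG; apply/matrixP => i j; rewrite !mxE FG. Qed.

Lemma mul_fun_mx I J L (F : I -> J -> int) (G : J -> L -> int) :
  fun_mx F *m fun_mx G = fun_mx (fun x z => \sum_y F x y * G y z).
Proof.
apply/matrixP => i j; rewrite !mxE [RHS](reindex (@enum_val J J)) /=.
  by apply: eq_bigr => k _; rewrite !mxE.
exact/onW_bij/enum_val_bij.
Qed.

Lemma add_fun_mx I J (F G : I -> J -> int) :
  fun_mx F + fun_mx G = fun_mx (fun x y => F x y + G x y).
Proof. by apply/matrixP => i j; rewrite !mxE. Qed.

Lemma fun_mx1 I : fun_mx (fun x y : I => (x == y)%:R) = 1.
Proof. by apply/matrixP => i j; rewrite !mxE (inj_eq enum_val_inj). Qed.

Lemma mxtrace_fun_mx I (F : I -> I -> int) : \tr (fun_mx F) = \sum_x F x x.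
Proof.
rewrite /mxtrace [RHS](reindex (@enum_val I I)) /=; last first.
  exact/onW_bij/enum_val_bij.
by apply: eq_bigr => k _; rewrite mxE.
Qed.

End FunctionMatrix.

(** * Boundary, field and projection matrices; trajectories as walks *)

Section VectorField.
Context {disp : Order.disp_t} {T : finOrderType disp}.
Variables (K : {set {set T}}) (V : {set {set T} * {set T}}).
Implicit Types (a b s t : {set T}).

Lemma facet_card a b : facet a b -> #|b| = #|a|.+1.
Proof. by case/facetP => x bx ->; rewrite (cardsD1 x b) bx. Qed.

Lemma facet_proper a b : facet a b -> a \proper b.
Proof.
move=> ab; rewrite properEcard (facet_card ab) leqnn andbT.
by case/andP: ab.
Qed.

Lemma card_simplex q (s : simplex K q) : #|val s| = q.+1.
Proof.
by case/andP: (valP s) => _ /eqP; rewrite /Defs.dim; move: #|_| => n; lia.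
Qed.

Lemma simplex_neq0 q (s : simplex K q) : val s != set0.
Proof. by rewrite -card_gt0 card_simplex. Qed.

Lemma dimE s (n : nat) : (Defs.dim s == n%:Z) = (#|s| == n.+1).
Proof. by rewrite /Defs.dim; apply/eqP/eqP; lia. Qed.

(** Matrix products sum over simplices of one degree, whereas steps of walks and [sum_incidence2]
    range over all sets; this passes between the two. *)
Lemma sum_simplex q (F : {set T} -> int) :
    (forall s, F s != 0 -> (s \in K) && (Defs.dim s == q%:Z)) ->
  \sum_(s : simplex K q) F (val s) = \sum_s F s.
Proof.
move=> supp_F; rewrite [RHS](bigID (fun s => (s \in K) && (Defs.dim s == q%:Z))).
rewrite /= [X in _ = _ + X]big1 ?addr0 => [|s]; last first.
  by apply: contraNeq; exact: supp_F.
rewrite [RHS](reindex_omap (val : simplex K q -> _) insub) /=; last first.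
  by move=> s Ks; rewrite insubT.
by apply: eq_bigl => s; rewrite valK eqxx andbT (valP s).
Qed.

(** Excluding [set0] keeps a vertex paired with [set0] among the critical simplices. *)
Definition is_head q (s : simplex K q) : bool :=
  [exists a, (a != set0) && ((a, val s) \in V)].
Definition is_tail q (s : simplex K q) : bool := [exists b, (val s, b) \in V].

Definition boundary_mx q :=
  fun_mx (fun (t : simplex K q) (s : simplex K q.+1) => incidence (val s) (val t)).
Definition field_mx q :=
  fun_mx (fun (b : simplex K q.+1) (a : simplex K q) =>
    if (val a, val b) \in V then - incidence (val b) (val a) else 0).
Definition head_mx q :=
  fun_mx (fun s t : simplex K q => ((s == t) && is_head t)%:R).
Definition tail_mx q :=
  fun_mx (fun s t : simplex K q => ((s == t) && is_tail s)%:R).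
Definition critical_mx q :=
  fun_mx (fun s t : simplex K q => ((s == t) && (s \in critical K V q))%:R).

(** The product W D in degree [q]; it is 0 in degree 0, where D is zero. *)
Definition field_boundary_mx q : 'M[int]_#|{: simplex K q}| :=
  if q is p.+1 then field_mx p *m boundary_mx p else 0.

Definition traj_step q (b : simplex K q) (p : {set T} * simplex K q) : bool :=
  [&& p.1 \in K, p.1 != set0, Defs.dim p.1 == q%:Z - 1, (p.1, val p.2) \in V,
      p.1 \proper val b & b != p.2].
Definition traj_step_weight q (b : simplex K q) (p : {set T} * simplex K q) :=
  - (incidence (val b) p.1 * incidence (val p.2) p.1).

Definition cotraj_step q (b : simplex K q) (p : {set T} * simplex K q) : bool :=
  [&& p.1 \in K, Defs.dim p.1 == q%:Z + 1, (val p.2, p.1) \in V,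
      val b \proper p.1 & b != p.2].
Definition cotraj_step_weight q (b : simplex K q) (p : {set T} * simplex K q) :=
  - (incidence p.1 (val b) * incidence p.1 (val p.2)).

Lemma trajectoryE q (b : simplex K q) P :
  trajectory V b P = walk (@traj_step q) b P.
Proof. by elim: P b => [|[a c] P IHP] b //=; rewrite IHP /traj_step /= -!andbA. Qed.

Lemma cotrajectoryE q (b : simplex K q) P :
  cotrajectory V b P = walk (@cotraj_step q) b P.
Proof. by elim: P b => [|[a c] P IHP] b //=; rewrite IHP /cotraj_step /= -!andbA. Qed.

Lemma critical_chainE q (b : simplex K q) : critical_chain V b =
  walk_sum (@traj_step q) (@traj_step_weight q) (@basis_chain _ _ K q) b.
Proof.
rewrite /critical_chain /walk_sum.
have -> : [set P | trajectory V b P]%classic =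
    [set P | walk (@traj_step q) b P]%classic.
  by apply/seteqP; split=> P /=; rewrite trajectoryE.
apply: eq_fsbigr => P _; congr (_ *: _).
by elim: P b => [|[a c] P IHP] b //=; rewrite IHP.
Qed.

Lemma cocritical_chainE q (b : simplex K q) : cocritical_chain V b =
  walk_sum (@cotraj_step q) (@cotraj_step_weight q) (@basis_chain _ _ K q) b.
Proof.
rewrite /cocritical_chain /walk_sum.
have -> : [set P | cotrajectory V b P]%classic =
    [set P | walk (@cotraj_step q) b P]%classic.
  by apply/seteqP; split=> P /=; rewrite cotrajectoryE.
apply: eq_fsbigr => P _; congr (_ *: _).
by elim: P b => [|[a c] P IHP] b //=; rewrite IHP.
Qed.

(** Critical chains are columns here, and co-critical chains are rows of the next matrix, so that L
    f R has the pairings [chain_dot] as entries. Both are formed for all simplices; [critical_mx]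
    selects the critical ones. *)
Definition critical_chain_mx q :=
  fun_mx (fun t b : simplex K q => critical_chain V b t).
Definition cocritical_chain_mx q :=
  fun_mx (fun b t : simplex K q => cocritical_chain V b t).

Hypothesis K_closed : forall s t, s \in K -> t \subset s -> t \in K.

Lemma boundary_mx_sqr q : boundary_mx q *m boundary_mx q.+1 = 0.
Proof.
rewrite mul_fun_mx; apply/matrixP => i j; rewrite !mxE.
set t := enum_val i; set s := enum_val j.
rewrite -[RHS](sum_incidence2 (val s) (val t)).
under [LHS]eq_bigr do rewrite mulrC.
apply: (@sum_simplex q.+1 (fun u => incidence (val s) u * incidence u (val t))) => u.
have [us _|/incidence0->] := boolP (facet u (val s)); last by rewrite mul0r eqxx.
(* Closure under faces puts every intermediate [u] with a nonzero term in [K]. *)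
rewrite (K_closed _ (proper_sub (facet_proper us))) ?(andP (valP s)).1 //= dimE.
by have := facet_card us; rewrite card_simplex => -[<-].
Qed.

Hypothesis V_dvf : discrete_vector_field K V.

Lemma field_facet a b : (a, b) \in V -> facet a b.
Proof. by move=> ab; have [/(_ _ ab)[? ? ?] _] := V_dvf. Qed.

Lemma field_in a b : (a, b) \in V -> (a \in K) /\ (b \in K).
Proof. by move=> ab; have [/(_ _ ab)[? ? ?] _] := V_dvf. Qed.

Lemma field_injl a b b' : (a, b) \in V -> (a, b') \in V -> b = b'.
Proof.
have [_ injV] := V_dvf => ab ab'.
by have [] : (a, b) = (a, b') by apply: (injV a); rewrite // /in_pair eqxx.
Qed.

Lemma field_injr a a' b : (a, b) \in V -> (a', b) \in V -> a = a'.
Proof.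
have [_ injV] := V_dvf => ab a'b.
by have [] : (a, b) = (a', b) by apply: (injV b); rewrite // /in_pair eqxx orbT.
Qed.

Lemma field_head_tail a b c : (a, b) \in V -> (b, c) \in V -> False.
Proof.
have [_ injV] := V_dvf => ab bc.
have [eq_ab _] : (a, b) = (b, c) by apply: (injV b); rewrite // /in_pair eqxx ?orbT.
by have := facet_card (field_facet ab); rewrite eq_ab; lia.
Qed.

Lemma head_tail q (s : simplex K q) : is_head s -> ~~ is_tail s.
Proof.
case/existsP=> a /andP[_ aV]; apply/existsP => -[b].
exact: field_head_tail aV.
Qed.

Lemma critical_mxE q : critical_mx q = 1 - tail_mx q - head_mx q.
Proof.
rewrite -fun_mx1; apply/matrixP => i j; rewrite !mxE.
case: eqP => [->|_]; last by rewrite !subr0.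
move: (enum_val j) => s /=.
have -> : (s \in critical K V q) = ~~ is_tail s && ~~ is_head s.
  rewrite inE; apply/orP/andP => [[]|].
  - move=> Ns; split; apply/existsP => -[x]; last case/andP=> _.
      move=> sV; case/existsP: Ns; exists (val s, x).
      by rewrite sV /in_pair eqxx.
    move=> sV; case/existsP: Ns; exists (x, val s).
    by rewrite sV /in_pair eqxx orbT.
  - case/andP=> _ sV; split; apply/existsP => -[x].
      by move=> sV'; apply: field_head_tail sV sV'.
    case/andP=> x0 sV'; case/eqP: x0; exact: field_injr sV' sV.
  case=> Nt Nh; case: (boolP [exists p in V, _]) => [|_]; last by left.
  case/existsP=> -[a b] /andP[abV] /orP[] /eqP eqs.
    have {}eqs : val s = a := eqs.
    by case/existsP: Nt; exists b; rewrite eqs.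
  have {}eqs : val s = b := eqs.
  right; have [a0|a0] := eqVneq a set0; last first.
    by case/existsP: Nh; exists a; rewrite a0 eqs.
  rewrite eqs -a0 abV andbT.
  (* A set having [set0] as a facet is a single vertex, hence [q = 0]. *)
  have := facet_card (field_facet abV).
  by rewrite -eqs card_simplex a0 cards0 => -[->].
(* Heads and tails are disjoint, so 1 - U - H takes only the values 0 and 1 on the diagonal. *)
have := @head_tail _ s.
by case: (is_head s) => [/(_ isT)/negPf ->|_]; last case: (is_tail s).
Qed.

Lemma head_mul_tail q : head_mx q *m tail_mx q = 0.
Proof.
rewrite mul_fun_mx; apply/matrixP => i j; rewrite !mxE big1 // => s _.
have := @head_tail _ s.
by case: (is_head s) => [/(_ isT)/negPf ->|_]; rewrite andbF ?mulr0 ?mul0r.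
Qed.

Lemma head_mul_field q : head_mx q.+1 *m field_mx q = field_mx q.
Proof.
rewrite mul_fun_mx; apply: eq_fun_mx => b a.
rewrite (bigD1 b) //= eqxx big1 ?addr0 => [|s /negPf]; last first.
  by rewrite eq_sym => ->; rewrite mul0r.
case: ifP => abV; last by rewrite mulr0.
suff -> : is_head b by rewrite mul1r.
by apply/existsP; exists (val a); rewrite simplex_neq0.
Qed.

Lemma field_mul_tail q : field_mx q *m tail_mx q = field_mx q.
Proof.
rewrite mul_fun_mx; apply: eq_fun_mx => b a.
rewrite (bigD1 a) //= eqxx big1 ?addr0 => [|s /negPf->]; last first.
  by rewrite mulr0.
case: ifP => abV; last by rewrite mul0r.
suff -> : is_tail a by rewrite mulr1.
by apply/existsP; exists (val b).
Qed.

End VectorField.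

(** * Critical chains of a gradient vector field *)

Section Gradient.
Context {disp : Order.disp_t} {T : finOrderType disp}.
Variables (K : {set {set T}}) (V : {set {set T} * {set T}}).
Implicit Types (a b s t : {set T}).
Hypothesis V_dvf : discrete_vector_field K V.

(** Off the diagonal, W D has the step weights as entries. On the diagonal there are no steps, since
    [b != b'], but W D is -1 at each head because incidence numbers square to 1; adding H cancels
    this. *)
Lemma traj_step_mx q :
  fun_mx (fun c b : simplex K q =>
    \sum_(a | traj_step V b (a, c)) traj_step_weight b (a, c)) =
  field_boundary_mx K V q + head_mx K V q.
Proof.
case: q => [|p].
  (* In degree 0 both sides vanish: a vertex has no nonempty facet. *)
  rewrite add0r; apply: eq_fun_mx => c b; rewrite big_pred0 => [|a]; last first.
    apply/negP => /and3P[/= _ a0 /andP[/eqP]]; rewrite /Defs.dim.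
    by move: a0; rewrite -card_gt0; move: #|_| => n; lia.
  case: (boolP (is_head V b)) => [/existsP[a /andP[a0 /(field_facet V_dvf)]]|_].
    move/facet_card; rewrite card_simplex => -[/esym/eqP].
    by rewrite cards_eq0 (negPf a0).
  by rewrite andbF.
rewrite /field_boundary_mx mul_fun_mx add_fun_mx; apply: eq_fun_mx => c b.
have V_dim a : (a, val c) \in V -> Defs.dim a == p%:Z.
  move/(field_facet V_dvf)/facet_card; rewrite card_simplex => -[ac].
  by rewrite dimE -ac.
rewrite (@sum_simplex _ _ K p (fun a =>
  (if (a, val c) \in V then - incidence (val c) a else 0) * incidence (val b) a));
  last first.
  move=> a; case: ifP => [ac _|_]; last by rewrite mul0r eqxx.
  by rewrite V_dim // (field_in V_dvf ac).1.
have [<-{b}|cNb] := eqVneq c b.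
  rewrite big_pred0 => [|a]; last by rewrite /traj_step /= eqxx !andbF.
  case: (boolP (is_head V c)) => [/existsP[a /andP[a0 ac]]|Nhead].
    rewrite (bigD1 a) //= ac mulNr incidence_sqr (field_facet V_dvf ac).
    rewrite big1 ?addr0 // => a' a'Na; case: ifP => [a'c|_]; last by rewrite mul0r.
    by rewrite (field_injr V_dvf a'c ac) eqxx in a'Na.
  rewrite big1 ?addr0 // => a _; case: ifP => [ac|_]; last by rewrite mul0r.
  case/existsP: Nhead; exists a; rewrite ac andbT -card_gt0.
  by have := facet_card (field_facet V_dvf ac); rewrite card_simplex => -[<-].
rewrite addr0 big_mkcond; apply: eq_bigr => a _.
case: (boolP ((a, val c) \in V)) => ac; last first.
  by rewrite /traj_step /= (negPf ac) !andbF /= mul0r.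
have [ab|/incidence0 ab0] := boolP (facet a (val b)); last first.
  by rewrite /traj_step_weight /= ab0 mulr0 mul0r oppr0 if_same.
rewrite /traj_step_weight /= mulNr mulrC ifT //.
rewrite /traj_step /= ac (facet_proper ab) [b == c]eq_sym cNb (field_in V_dvf ac).1.
rewrite -card_gt0.
have := facet_card ab; rewrite card_simplex => -[<-] /=.
by move/eqP: (V_dim a ac) => ->; rewrite andbT; apply/eqP; lia.
Qed.

(** As for trajectories, the diagonal of D W is -1 at each tail, and U cancels it. *)
Lemma cotraj_step_mx q :
  fun_mx (fun b c : simplex K q =>
    \sum_(t | cotraj_step V b (t, c)) cotraj_step_weight b (t, c)) =
  boundary_mx K q *m field_mx K V q + tail_mx K V q.
Proof.
rewrite mul_fun_mx add_fun_mx; apply: eq_fun_mx => b c.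
have V_dim t : (val c, t) \in V -> Defs.dim t == q.+1%:Z.
  by move/(field_facet V_dvf)/facet_card; rewrite card_simplex dimE => ->.
rewrite (@sum_simplex _ _ K q.+1 (fun t =>
  incidence t (val b) * (if (val c, t) \in V then - incidence t (val c) else 0)));
  last first.
  move=> t; case: ifP => [ct _|_]; last by rewrite mulr0 eqxx.
  by rewrite V_dim // (field_in V_dvf ct).2.
have [->{b}|bNc] := eqVneq b c.
  rewrite big_pred0 => [|t]; last by rewrite /cotraj_step /= eqxx !andbF.
  case: (boolP (is_tail V c)) => [/existsP[t ct]|Ntail].
    rewrite (bigD1 t) //= ct mulrN incidence_sqr (field_facet V_dvf ct).
    rewrite big1 ?addr0 // => t' t'Nt; case: ifP => [ct'|_]; last by rewrite mulr0.
    by rewrite (field_injl V_dvf ct' ct) eqxx in t'Nt.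
  rewrite big1 ?addr0 // => t _; case: ifP => [ct|_]; last by rewrite mulr0.
  by case/existsP: Ntail; exists t.
rewrite addr0 big_mkcond; apply: eq_bigr => t _.
case: (boolP ((val c, t) \in V)) => ct; last first.
  by rewrite /cotraj_step /= (negPf ct) !andbF /= mulr0.
have [bt|/incidence0 bt0] := boolP (facet (val b) t); last first.
  by rewrite /cotraj_step_weight /= bt0 !mul0r oppr0 if_same.
rewrite /cotraj_step_weight /= mulrN ifT //.
rewrite /cotraj_step /= ct (facet_proper bt) bNc (field_in V_dvf ct).2.
by move/eqP: (V_dim t ct) => ->; rewrite andbT; apply/eqP; lia.
Qed.

Hypothesis V_acyclic : forall q (b : simplex K q) P,
  trajectory V b P -> ~~ nontrivial_closed b P.

Lemma size_trajectory q (b : simplex K q) P :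
  walk (@traj_step _ _ K V q) b P -> (size P <= #|{: simplex K q}|)%N.
Proof.
move=> bP; apply: ltnW; apply: size_walk bP => {}b {}P.
rewrite -trajectoryE => /V_acyclic.
by rewrite negb_and negbK => /orP[->|].
Qed.

(* Read backwards, the cofaces of a co-trajectory form a trajectory. *)
Lemma cotrajectory_rev q (b : simplex K q) t c P :
    walk (@cotraj_step _ _ K V q) b ((t, c) :: P) ->
  exists (t0 : simplex K q.+1) Q, [/\ walk (@traj_step _ _ K V q.+1) t0 Q,
    val (last t0 (unzip2 Q)) = t & size Q = size P].
Proof.
elim: P b t c => [|[t' c'] P IHP] b t c.
  rewrite /= andbT => /and3P[/= Kt dt _].
  have Kdt : (t \in K) && (Defs.dim t == q.+1%:Z).
    by rewrite Kt (eqP dt); apply/eqP; lia.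
  by exists (Sub t Kdt), [::]; split; rewrite //= SubK.
move=> /andP[/and5P[/= Kt dt ct _ _] ctP].
have [t0 [Q [t0Q lastQ sizeQ]]] := IHP _ _ _ ctP.
have Kdt : (t \in K) && (Defs.dim t == q.+1%:Z).
  by rewrite Kt (eqP dt); apply/eqP; lia.
pose u : simplex K q.+1 := Sub t Kdt.
have [/and5P[/= _ _ ct' cpt' cNc'] _] := andP ctP.
exists t0, (rcons Q (val c, u)); split; last by rewrite size_rcons sizeQ.
  rewrite -cats1 walk_cat t0Q /= andbT; apply/and5P; split=> //=.
  - by case/andP: (valP c).
  - exact: simplex_neq0.
  - by rewrite /Defs.dim card_simplex.
  (* Equal consecutive cofaces would be matched with the same face, forcing [c = c']. *)
  rewrite lastQ cpt' /=; apply: contraNneq cNc' => last_u.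
  apply/eqP/val_inj/(field_injr V_dvf ct).
  by rewrite -lastQ last_u in ct'.
by rewrite /unzip2 map_rcons last_rcons.
Qed.

(** Acyclicity is assumed for trajectories only, so the bound comes from the reversed trajectory one
    degree higher. It has one step fewer, whence the extra successor. *)
Lemma size_cotrajectory q (b : simplex K q) P :
  walk (@cotraj_step _ _ K V q) b P -> (size P <= #|{: simplex K q.+1}|.+1)%N.
Proof.
case: P => [//|[t c] P] /cotrajectory_rev[t0 [Q [t0Q _ sizeQ]]].
rewrite /= ltnS -sizeQ; exact: size_trajectory t0Q.
Qed.

(** Since chains are columns, splitting off the first step multiplies by the step matrix on the
    right; for the rows of L it is on the left. *)
Lemma critical_chain_mx_rec q :
  critical_chain_mx K V q = 1 + critical_chain_mx K V q *
    (field_boundary_mx K V q + head_mx K V q).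
Proof.
rewrite -traj_step_mx -fun_mx1 [X in _ + X]mul_fun_mx add_fun_mx.
apply: eq_fun_mx => t b.
rewrite critical_chainE (walk_sum_rec _ _ (@size_trajectory q)).
rewrite ffunE ffunE sum_ffunE; congr (_ + _).
under [RHS]eq_bigr do rewrite mulr_sumr.
rewrite (eq_bigl (fun p => traj_step V b (p.1, p.2))); last by case.
rewrite [RHS](exchange_big_dep predT) //= pair_big_dep /=.
by apply: eq_bigr => -[a c] _; rewrite ffunE mulrC critical_chainE.
Qed.

Lemma cocritical_chain_mx_rec q :
  cocritical_chain_mx K V q = 1 +
    (boundary_mx K q *m field_mx K V q + tail_mx K V q) * cocritical_chain_mx K V q.
Proof.
rewrite -cotraj_step_mx -fun_mx1 [X in _ + X]mul_fun_mx add_fun_mx.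
apply: eq_fun_mx => b t.
rewrite cocritical_chainE (walk_sum_rec _ _ (@size_cotrajectory q)).
rewrite ffunE ffunE sum_ffunE eq_sym; congr (_ + _).
under [RHS]eq_bigr do rewrite mulr_suml.
rewrite (eq_bigl (fun p => cotraj_step V b (p.1, p.2))); last by case.
rewrite [RHS](exchange_big_dep predT) //= pair_big_dep /=.
by apply: eq_bigr => -[a c] _; rewrite ffunE cocritical_chainE.
Qed.

End Gradient.

(** * The homotopy and its trace *)

(** Put [a = 1 - (v + h)] and [b = 1 - (u + t)]. The recursions say [r * a = 1] and [b * l = 1], and
    the vanishing products give [c = a * b + a * u + v * b]. Multiplying by [r] and [l] then cancels
    [a] and [b]. *)
Lemma perturbed_inverse (S : pzRingType) (v u h t c r l : S) :
    c = 1 - t - h -> v * u = 0 -> h * t = 0 ->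
    r = 1 + r * (v + h) -> l = 1 + (u + t) * l ->
  r * c * l = 1 + u * l + r * v.
Proof.
move=> cE vu0 ht0 rE lE.
have ra : r * (1 - (v + h)) = 1 by rewrite mulrBr mulr1 {1}rE addrK.
have bl : (1 - (u + t)) * l = 1 by rewrite mulrBl mul1r {1}lE addrK.
have -> : c = (1 - (v + h)) * (1 - (u + t)) + (1 - (v + h)) * u + v * (1 - (u + t)).
  have -> : v * (1 - (u + t)) = v - v * t.
    by rewrite mulrBr mulr1 mulrDr vu0 add0r.
  have -> : (1 - (v + h)) * (1 - (u + t)) + (1 - (v + h)) * u =
      1 - (v + h) - (t - v * t).
    rewrite -mulrDr [u + t]addrC [- (t + u)]opprD [1 + (- t - u)]addrA subrK.
    by rewrite mulrBr mulr1 mulrBl mul1r mulrDl ht0 addr0.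
  rewrite opprB -addrA [v * t - t + _]addrC subrKA.
  by rewrite [v + h]addrC opprD [1 + (- h - v)]addrA subrKA addrAC.
move: (1 - (v + h)) ra (1 - (u + t)) bl => a ra b bl.
rewrite !mulrDr !mulrDl !mulrA ra !mul1r bl.
by rewrite -[r * v * b * l]mulrA bl mulr1.
Qed.

(** * Homotopy in each degree, traces of chain maps and telescoping *)

Section Trace.
Context {disp : Order.disp_t} {T : finOrderType disp}.
Variables (K : {set {set T}}) (V : {set {set T} * {set T}}).
Hypothesis K_closed : forall s t : {set T}, s \in K -> t \subset s -> t \in K.
Hypothesis V_gradient : gradient_vector_field K V.

Lemma critical_projectionE q :
  critical_chain_mx K V q * critical_mx K V q * cocritical_chain_mx K V q =
  1 + boundary_mx K q *m field_mx K V q * cocritical_chain_mx K V q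
    + critical_chain_mx K V q * field_boundary_mx K V q.
Proof.
have [V_dvf V_acyclic] := V_gradient.
apply: perturbed_inverse.
- exact: critical_mxE.
(* The product (W D)(D W) contains D D; in degree 0 its first factor is 0. *)
- case: q => [|q]; first by rewrite mul0r.
  rewrite /= -mulmxE -mulmxA [boundary_mx K q *m _]mulmxA boundary_mx_sqr //.
  by rewrite mul0mx mulmx0.
- exact: head_mul_tail.
- exact: critical_chain_mx_rec.
exact: cocritical_chain_mx_rec.
Qed.

(** As H W = W and W U = W, the recursions reduce to R W D W = -W and W D W L = -W. Evaluating R W D
    W L in both ways gives -W L = -R W. *)
Lemma critical_chain_mul_field q :
  critical_chain_mx K V q.+1 *m field_mx K V q =
  field_mx K V q *m cocritical_chain_mx K V q.
Proof.
have [V_dvf V_acyclic] := V_gradient.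
set R := critical_chain_mx K V q.+1; set L := cocritical_chain_mx K V q.
set W := field_mx K V q; set D := boundary_mx K q.
have RWDW : R *m W *m D *m W = - W.
  have : R *m W = W + R *m W *m D *m W + R *m W.
    rewrite {1}/R critical_chain_mx_rec // -/R /= -/W -/D -mulmxE.
    rewrite mulmxDr !mulmxDl mul1mx -[R *m head_mx _ _ _ *m _]mulmxA head_mul_field.
    by rewrite !mulmxA addrA.
  move=> eq_RW; apply/eqP; rewrite -addr_eq0 addrC; apply/eqP.
  by apply: (addIr (R *m W)); rewrite add0r -eq_RW.
have WDWL : W *m D *m W *m L = - W.
  have : W *m L = W + W *m D *m W *m L + W *m L.
    rewrite {1}/L cocritical_chain_mx_rec // -/L -/W -/D -mulmxE.
    rewrite !mulmxDl !mulmxDr mulmx1 [W *m (tail_mx _ _ _ *m _)]mulmxA field_mul_tail.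
    by rewrite !mulmxA addrA.
  move=> eq_WL; apply/eqP; rewrite -addr_eq0 addrC; apply/eqP.
  by apply: (addIr (W *m L)); rewrite add0r -eq_WL.
apply: oppr_inj; rewrite -mulmxN -WDWL -mulNmx -RWDW.
by rewrite !mulmxA.
Qed.

Lemma sum_basis_chain q (F : simplex K q -> int) s :
  (\sum_t F t *: basis_chain t) s = F s.
Proof.
transitivity (\sum_t F t * (s == t)%:R).
  by rewrite sum_ffunE; apply: eq_bigr => t _; rewrite ffunE ffunE.
rewrite (bigD1 s) ?inE // eqxx mulr1 big1 => [|t /andP[_ tNs]]; first exact: addr0.
by rewrite eq_sym (negPf tNs) mulr0.
Qed.

Lemma chain_basis q (c : chain K q) : c = \sum_t c t *: basis_chain t.
Proof. by apply/ffunP => s; rewrite sum_basis_chain. Qed.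

Lemma linear_chainE q (f : {linear chain K q -> chain K q}) (c : chain K q) s :
  f c s = \sum_t f (basis_chain t) s * c t.
Proof.
rewrite {1}[c]chain_basis linear_sum sum_ffunE; apply: eq_bigr => t _.
by rewrite linearZ ffunE mulrC.
Qed.

Lemma chain_mxE q (f : {linear chain K q -> chain K q}) :
  chain_mx f = fun_mx (fun s t => f (basis_chain t) s).
Proof. by []. Qed.

Lemma chain_dot_mx q (f : {linear chain K q -> chain K q}) :
  fun_mx (fun b c => chain_dot (cocritical_chain V b) (f (critical_chain V c))) =
  cocritical_chain_mx K V q *m chain_mx f *m critical_chain_mx K V q.
Proof.
rewrite -mulmxA chain_mxE !mul_fun_mx; apply: eq_fun_mx => b c.
by apply: eq_bigr => s _; rewrite linear_chainE.
Qed.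

(** The summands are the diagonal entries of L f R selected by C; cyclicity of the trace moves L to
    the end. *)
Lemma sum_critical_dot q (f : {linear chain K q -> chain K q}) :
  \sum_(s in critical K V q)
    chain_dot (cocritical_chain V s) (f (critical_chain V s)) =
  \tr (chain_mx f *m (critical_chain_mx K V q * critical_mx K V q *
                      cocritical_chain_mx K V q)).
Proof.
rewrite -mulmxE !mulmxA mxtrace_mulC !mulmxA -chain_dot_mx mul_fun_mx.
rewrite mxtrace_fun_mx [LHS]big_mkcond; apply: eq_bigr => s _.
rewrite (bigD1 s) //= eqxx big1 ?addr0 => [|t /negPf->]; last by rewrite mulr0.
by case: ifP; rewrite ?mulr1 ?mulr0.
Qed.

Lemma boundaryE q (c : chain K q.+1) t :
  boundary c t = \sum_s incidence (val s) (val t) * c s.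
Proof.
rewrite sum_ffunE; apply: eq_bigr => s _; rewrite ffunE.
by rewrite [X in _ *: X]sum_basis_chain [LHS]mulrC.
Qed.

Lemma boundary_mulC (phi : forall q, {linear chain K q -> chain K q}) q :
    chain_map phi ->
  boundary_mx K q *m chain_mx (phi q.+1) = chain_mx (phi q) *m boundary_mx K q.
Proof.
move=> phi_chain; rewrite !chain_mxE !mul_fun_mx; apply: eq_fun_mx => t s.
rewrite -boundaryE phi_chain linear_chainE; apply: eq_bigr => u _.
congr (_ * _); rewrite boundaryE (bigD1 s) //= ffunE eqxx big1 => [|v vNs].
  by rewrite addr0 mulr1.
by rewrite ffunE (negPf vNs) mulr0.
Qed.

(** The contribution of the half R W D of the homotopy. *)
Definition trace_defect q (f : {linear chain K q -> chain K q}) : int :=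
  \tr (chain_mx f *m (critical_chain_mx K V q * field_boundary_mx K V q)).

(** The other half D W L contributes the defect of the next degree: use R W = W L, cyclicity of the
    trace and the commutation of [phi] with D. *)
Lemma sum_critical_dotE (phi : forall q, {linear chain K q -> chain K q}) q :
    chain_map phi ->
  \sum_(s in critical K V q)
    chain_dot (cocritical_chain V s) (phi q (critical_chain V s)) =
  chain_tr (phi q) + (trace_defect (phi q.+1) + trace_defect (phi q)).
Proof.
move=> phi_chain; rewrite sum_critical_dot critical_projectionE.
rewrite !mulmxDr !mxtraceD mulmx1 -addrA; congr (_ + (_ + _)).
rewrite /trace_defect /= -!mulmxE [critical_chain_mx K V q.+1 *m _]mulmxA.
rewrite critical_chain_mul_field [RHS]mxtrace_mulC.
rewrite -[_ *m boundary_mx K q *m chain_mx _]mulmxA (boundary_mulC q phi_chain).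
by rewrite [RHS]mxtrace_mulC !mulmxA.
Qed.

(** The defects telescope. The one in degree 0 is 0, as W D is 0 there, so only the term at [n]
    remains. *)
Lemma alternating_sum_critical_dot
    (phi : forall q, {linear chain K q -> chain K q}) n :
    chain_map phi ->
  \sum_(q < n) (-1) ^+ q * \sum_(s in critical K V q)
      chain_dot (cocritical_chain V s) (phi q (critical_chain V s)) =
  \sum_(q < n) (-1) ^+ q * chain_tr (phi q) - (-1) ^+ n * trace_defect (phi n).
Proof.
move=> phi_chain; elim: n => [|n IHn].
  by rewrite !big_ord0 /trace_defect mulr0 mulmx0 mxtrace0 mulr0 subrr.
rewrite !big_ord_recr /= IHn sum_critical_dotE //.
by rewrite exprS; ring.
Qed.

End Trace.

Theorem theorem1p10 (disp : Order.disp_t) (T : finOrderType disp)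
    (K : {set {set T}}) (d : int) (V : {set {set T} * {set T}})
    (phi : forall q : nat, {linear chain K q -> chain K q})
    (HK : simplicial_complex K) (Hd : has_dimension K d)
    (HV : gradient_vector_field K V) (Hphi : chain_map phi) :
  (* q ranges over 0, ..., d, as d + 1 is nonnegative *)
  \sum_(q < absz (d + 1)) (-1) ^+ q * chain_tr (phi q) =
  \sum_(q < absz (d + 1)) (-1) ^+ q *
    \sum_(s in critical K V q)
      chain_dot (cocritical_chain V s) (phi q (critical_chain V s)).
Proof.
have [_ K_closed] := HK; have [[s0 _ dim_s0] dim_le] := Hd.
rewrite alternating_sum_critical_dot //.
suff -> : trace_defect V (phi (absz (d + 1))) = 0 by rewrite mulr0 subr0.
(* The trace is an empty sum: [s0] gives [d >= -1], so an index [i] would be a simplex of dimension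
   [d + 1]. *)
apply: big1 => i _; have /andP[Ks /eqP dim_s] := valP (enum_val i).
exfalso; have := dim_le _ Ks; rewrite dim_s; move: dim_s0.
by rewrite /Defs.dim; lia.
Qed.
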